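(* Let $a<b$, $K\ge2$, $\mathcal{I}=\{1,\dots,K\}$, $\mathscr{D}\subseteq D_{cdf}([a,b])$ nonempty and convex, and $\mathsf{T}:D_{cdf}([a,b])\to\mathbb{R}$ with $|\mathsf{T}(F)-\mathsf{T}(G)|\le C\|F-G\|_\infty$ for all $F\in\mathscr{D}$, $G\in D_{cdf}([a,b])$, for some $C>0$. Assume that for every $m\in\mathbb{N}$ and $\delta\in\mathscr{S}_m$ the map $x\mapsto\mathsf{T}(\sum_{j=1}^m\delta_j\mathbf{1}\{x_j\le\cdot\})$ on $[a,b]^m$ is Borel measurable. Let $\mathscr{M}_K\subseteq\mathscr{S}_K$ be closed with at least two elements. Let $n\ge K$, let $\Pi_n=(\Pi_{n,1},\dots,\Pi_{n,K})$ be a partition of $\{1,\dots,n\}$ into nonempty sets, let $\mathscr{M}_K^n\subseteq\mathscr{M}_K$ be nonempty and finite, and set $\beta_n=\min_j|\Pi_{n,j}|$. Then the static assignment policy $\hat\pi$ satisfies $$\sup_{F^1,\dots,F^K\in\mathscr{D}}\mathbb{E}[r_n(\hat\pi,\mathscr{M}_K)]\le\varepsilon(n)+3.01\,C\sqrt{\log(K)/\beta_n},$$ where the supremum is over all i.i.d. potential outcome distributions whose marginal cdfs $F^1,\dots,F^K$ lie in $\mathscr{D}$ (arbitrary dependence between components).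
   Context: $D_{cdf}([a,b])$: cdfs $F$ on $\mathbb{R}$ with $F(a-)=0$, $F(b)=1$; $\|\cdot\|_\infty$ sup norm; $\mathscr{S}_K=\{\delta\in[0,1]^K:\sum\delta_i=1\}$; $\langle\delta,\mathbf{F}\rangle=\sum_i\delta_iF^i$. Setting: potential outcome vectors $Y_t=(Y_{1,t},\dots,Y_{K,t})$, $t\in\mathbb{N}$, i.i.d., $Y_{i,t}$ with cdf $F^i$. Static assignment (SA) policy $\hat\pi$: subject $t\in\{1,\dots,n\}$ is assigned to treatment $j$ iff $t\in\Pi_{n,j}$; then $\hat F^j_{n,\Pi_n}(\cdot)=|\Pi_{n,j}|^{-1}\sum_{t\in\Pi_{n,j}}\mathbf{1}\{Y_{j,t}\le\cdot\}$, $\hat{\mathbf{F}}_{n,\Pi_n}=(\hat F^1_{n,\Pi_n},\dots,\hat F^K_{n,\Pi_n})$, and the recommendation is $\hat\pi_{n,n+1}=\min\arg\max_{\delta\in\mathscr{M}_K^n}\mathsf{T}(\langle\delta,\hat{\mathbf{F}}_{n,\Pi_n}\rangle)$, the minimum with respect to the lexicographic order on $\mathbb{R}^K$. Regret: $r_n(\hat\pi,\mathscr{M}_K)=\max_{\delta\in\mathscr{M}_K}\mathsf{T}(\langle\delta,\mathbf{F}\rangle)-\mathsf{T}(\langle\hat\pi_{n,n+1},\mathbf{F}\rangle)$. Optimization error: $\varepsilon(n)=\sup_{\mathbf{F}\in\mathscr{D}^K}\big|\max_{\delta\in\mathscr{M}_K}\mathsf{T}(\langle\delta,\mathbf{F}\rangle)-\max_{\delta\in\mathscr{M}_K^n}\mathsf{T}(\langle\delta,\mathbf{F}\rangle)\big|$.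 *)

(* Defs.v *)
From mathcomp Require Import all_boot all_order all_algebra.
From mathcomp Require Import all_classical all_reals all_analysis.
Export Order.TTheory GRing.Theory Num.Theory.
Export numFieldNormedType.Exports.

Set Implicit Arguments.
Unset Strict Implicit.
Unset Printing Implicit Defensive.

Local Open Scope ring_scope.
Local Open Scope classical_set_scope.

Section Defs.
Variable R : realType.

Definition is_cdf (F : R -> R) : Prop :=
  [/\ {homo F : x y / x <= y},
      (forall x, F y @[y --> x^'+] --> F x),
      F x @[x --> -oo] --> (0:R) &
      F x @[x --> +oo] --> (1:R)].

Definition Dcdf (a b : R) : set (R -> R) :=
  [set F | [/\ is_cdf F, F x @[x --> a^'-] --> (0:R) & F b = 1]].

Definition supnorm (F G : R -> R) : R := sup (range (fun x => `|F x - G x|)).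

Definition simplex (K : nat) : set 'rV[R]_K :=
  [set d | (forall i, 0 <= d ord0 i <= 1) /\ \sum_(i < K) d ord0 i = 1].

Definition mix (K : nat) (d : 'rV[R]_K) (F : 'I_K -> R -> R) : R -> R :=
  fun x => \sum_(i < K) d ord0 i * F i x.

Definition lexlt (K : nat) (d d' : 'rV[R]_K) : Prop :=
  exists i : 'I_K, (forall j : 'I_K, (j < i)%N -> d ord0 j = d' ord0 j) /\
                   d ord0 i < d' ord0 i.

(* max_{delta in M} T(<delta, F>) (the maximum exists in the situation of the
   theorem; it coincides with the supremum) *)
Definition optval (K : nat) (T : (R -> R) -> R) (M : set 'rV[R]_K)
  (F : 'I_K -> R -> R) : R := sup [set T (mix d F) | d in M].

Definition opt_error (K : nat) (T : (R -> R) -> R) (D : set (R -> R))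
  (M Mn : set 'rV[R]_K) : R :=
  sup [set `|optval T M F - optval T Mn F|
       | F in [set F : 'I_K -> R -> R | forall i, D (F i)]].

Definition argmaxset (K : nat) (T : (R -> R) -> R) (Mn : set 'rV[R]_K)
  (G : 'I_K -> R -> R) : set 'rV[R]_K :=
  [set d | Mn d /\ forall d', Mn d' -> T (mix d' G) <= T (mix d G)].

(* the lexicographic minimum of a set (a singleton or empty) *)
Definition lexmin_set (K : nat) (S : set 'rV[R]_K) : set 'rV[R]_K :=
  [set d | S d /\ forall d', S d' -> d' <> d -> lexlt d d'].

Definition lexmin (K : nat) (S : set 'rV[R]_K) : 'rV[R]_K :=
  xget 0 (lexmin_set S).

(* empirical cdfs of the static assignment policy:
   hat F^j(x) = |Pi_j|^{-1} sum_{t in Pi_j} 1{Y_{j,t} <= x};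
   subjects are t = 0, ..., n-1 (i.e. subject t+1 of the paper) *)
Definition ecdf_SA (K n : nat) (Pi : 'I_K -> {set 'I_n})
  (y : nat -> K.-tuple R) : 'I_K -> R -> R :=
  fun j x => (#|Pi j|%:R)^-1 *
             \sum_(t in Pi j) ((tnth (y (nat_of_ord t)) j <= x)%R : bool)%:R.

Definition SA_recommendation (K n : nat) (T : (R -> R) -> R)
  (Mn : set 'rV[R]_K) (Pi : 'I_K -> {set 'I_n}) (y : nat -> K.-tuple R)
  : 'rV[R]_K :=
  lexmin (argmaxset T Mn (ecdf_SA Pi y)).

Definition SA_regret (K n : nat) (T : (R -> R) -> R) (M Mn : set 'rV[R]_K)
  (Pi : 'I_K -> {set 'I_n}) (F : 'I_K -> R -> R) (y : nat -> K.-tuple R) : R :=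
  optval T M F - T (mix (SA_recommendation T Mn Pi y) F).

Definition is_partition_nonempty (K n : nat) (Pi : 'I_K -> {set 'I_n}) : Prop :=
  [/\ forall j, Pi j != finset.set0,
      forall t : 'I_n, exists j, t \in Pi j &
      forall j j' (t : 'I_n), t \in Pi j -> t \in Pi j' -> j = j'].

Definition beta_n (K n : nat) (Pi : 'I_K -> {set 'I_n}) : nat :=
  \big[minn/n]_(j < K) #|Pi j|.

Definition T_of_sample (m : nat) (T : (R -> R) -> R) (d : 'rV[R]_m)
  (x : m.-tuple R) : R :=
  T (fun y => \sum_(j < m) d ord0 j * ((tnth x j <= y)%R : bool)%:R).

End Defs.

Section Prob.
Local Open Scope ereal_scope.
Variables (d : measure_display) (Omega : measurableType d) (R : realType).

(* a sequence (Y_t)_{t in N} of random vectors in R^K (K.-tuple R with the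
   product sigma-algebra) that is independent and identically distributed *)
Definition iid_vectors (K : nat) (P : probability Omega R)
  (Y : nat -> Omega -> K.-tuple R) : Prop :=
  [/\ forall t, measurable_fun setT (Y t),
      (forall t s (A : set (K.-tuple R)), measurable A ->
         P (Y t @^-1` A) = P (Y s @^-1` A)) &
      (forall (s : seq nat) (A : nat -> set (K.-tuple R)), uniq s ->
         (forall t, measurable (A t)) ->
         P (\big[setI/setT]_(t <- s) (Y t @^-1` A t)) =
         \prod_(t <- s) P (Y t @^-1` A t))].

End Prob.

(* Main.v *)
Require Import Defs.
From mathcomp Require Import all_boot all_order all_algebra.
From mathcomp Require Import all_classical all_reals all_analysis.
From mathcomp Require Import measurable_realfun ring lra.
Import Order.TTheory GRing.Theory Num.Theory.
Import numFieldNormedType.Exports.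
Set Implicit Arguments.
Unset Strict Implicit.
Unset Printing Implicit Defensive.
Local Open Scope ring_scope.
Local Open Scope classical_set_scope.

(** On the event that all empirical cdfs are uniformly within [u] of the true
ones, two applications of the Lipschitz bound show that the regret is at most
[opt_error + 2 C u]. It remains to bound the maximal deviation in mean, which
needs a Dvoretzky-Kiefer-Wolfowitz inequality with explicit constants.

For [m] observations let [N t] be the number of those with level at most [t],
and [p t] its normalized mean. Read from the highest level downwards,
[(1 + theta / p t) ^ N t] is a martingale with mean [(1 + theta) ^ m]. With
[theta = 2 x], at the first crossing of [N t >= m (p t + x)] it is at least
[expR (31/20 m x^2) (1 + 2 x) ^ m], whatever the level, so that crossing has
probability at most [expR (- 31/20 m x^2)]. The exponent 2 is optimal, but
31/20 suffices here. This is an inequality on the masses of nested events, so it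
applies to both tails and to an arbitrary cdf.

Hence the square [W] of the maximal deviation over the [K] arms satisfies
[P (W > y) <= 2 K expR (- 31/20 beta y)], so that
[E W <= (ln (2 K) + 1) / (31/20 beta) < (3.01 / 2)^2 ln K / beta], because
[ln 2 >= 2/3]. *)

(** * The exponent of the crossing probability *)

Lemma ler_is_derive (R : realType) (f df : R -> R) (c : R) :
  0 <= c -> (forall x, 0 <= x <= c -> is_derive x 1 f (df x)) ->
  (forall x, 0 <= x <= c -> 0 <= df x) -> f 0 <= f c.
Proof.
move=> c0 fdf df0.
have fcont : {within `[0, c], continuous f}.
  apply: derivable_within_continuous => x; rewrite in_itv/= => /fdf dfx.
  exact: ex_derive.
have fdf' x : x \in `]0, c[%R -> is_derive x 1 f (df x).
  by rewrite in_itv/= => /andP[x0 xc]; apply: fdf; rewrite !ltW.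
have [x xc fE] := MVT_segment c0 fdf' fcont.
by rewrite -subr_ge0 fE subr0 mulr_ge0// df0// -in_itv.
Qed.

Lemma is_derive_ln1D (R : realType) (x : R) : 0 < 1 + x ->
  is_derive x (1 : R) (fun x : R => ln (1 + x)) (1 + x)^-1.
Proof.
move=> x0; have dg : is_derive x (1 : R) (fun x : R => 1 + x) 1.
  have := is_deriveD (is_derive_cst (1 : R) x 1) (is_derive_id x 1).
  by rewrite add0r.
have := is_derive1_comp (g := fun x : R => 1 + x) (is_derive1_ln x0) dg.
by rewrite mulr1.
Qed.

(** The left side truncates the odd series of [2 artanh u]; the derivative of the difference is
    [2 x^6 / (1 - x^2)]. *)
Lemma ln_ratio_ge (R : realType) (u : R) : 0 <= u < 1 ->
  2 * (u + u ^+ 3 / 3 + u ^+ 5 / 5) <= ln (1 + u) - ln (1 - u).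
Proof.
move=> /andP[u0 u1].
pose f (x : R) : R :=
  ln (1 + x) - ln (1 - x) - 2 * (x + x ^+ 3 / 3 + x ^+ 5 / 5).
pose df (x : R) : R := (1 + x)^-1 + (1 - x)^-1 - 2 * (1 + x ^+ 2 + x ^+ 4).
have fdf x : 0 <= x <= u -> is_derive x 1 f (df x).
  move=> /andP[x0 xu].
  have Hp : 0 < 1 + x by lra.
  have Hm : 0 < 1 - x by lra.
  have d1 := is_derive_ln1D Hp.
  have d2 : is_derive x (1 : R) (fun x : R => ln (1 - x)) (- (1 - x)^-1).
    have dg : is_derive x (1 : R) (fun x : R => 1 - x) (-1).
      have := is_deriveB (is_derive_cst (1 : R) x 1) (is_derive_id x 1).
      by rewrite add0r.
    have := is_derive1_comp (g := fun x : R => 1 - x) (is_derive1_ln Hm) dg.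
    by rewrite mulrN1.
  have dX k : is_derive x (1 : R) (fun x : R => x ^+ k.+1) (k.+1%:R * x ^+ k).
    have := is_deriveX k.+1 (is_derive_id x (1 : R)).
    by rewrite exprfctE /GRing.scale/= mulr1.
  have := is_deriveB (is_deriveB d1 d2)
    (is_deriveZ (2 : R) (is_deriveD (is_deriveD (is_derive_id x (1 : R))
       (is_deriveZ (3^-1 : R) (dX 2%N))) (is_deriveZ (5^-1 : R) (dX 4%N)))).
  move=> H.
  rewrite (_ : f = (fun x : R => ln (1 + x) - ln (1 - x) -
     2 * (x + 3^-1 * x ^+ 3 + 5^-1 * x ^+ 5))); last first.
    by apply: funext => z; rewrite /f; ring.
  apply: (is_derive_eq H).
  by rewrite /df /GRing.scale/=; field; rewrite !gt_eqF.
have df0 x : 0 <= x <= u -> 0 <= df x.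
  move=> /andP[x0 xu]; rewrite /df.
  have Hp : 0 < 1 + x by lra.
  have Hm : 0 < 1 - x by lra.
  have -> : (1 + x)^-1 + (1 - x)^-1 - 2 * (1 + x ^+ 2 + x ^+ 4)
          = 2 * x ^+ 6 / ((1 + x) * (1 - x)).
    by field; rewrite !gt_eqF.
  by rewrite divr_ge0 ?mulr_ge0 ?exprn_ge0// ltW.
have := ler_is_derive u0 fdf df0.
by rewrite /f addr0 subr0 ln1 !expr0n/=; lra.
Qed.

(** The right side is the Pade approximant [y (y + 6) / (4 y + 6)], split into partial fractions for
    differentiation. The gap vanishes at [0] and has derivative [4 x^3 / ((4 x + 6)^2 (1 + x))]. *)
Lemma ln1D_le_pade (R : realType) (y : R) : 0 <= y ->
  ln (1 + y) <= y / 4 + 9 / 8 - 27 / 4 * (4 * y + 6)^-1.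
Proof.
move=> y0.
pose f (x : R) : R := x / 4 + 9 / 8 - 27 / 4 * (4 * x + 6)^-1 - ln (1 + x).
pose df (x : R) : R := 1 / 4 + 27 * (4 * x + 6) ^- 2 - (1 + x)^-1.
have fdf x : 0 <= x <= y -> is_derive x 1 f (df x).
  move=> /andP[x0 xy].
  have Hp : 0 < 1 + x by lra.
  have Hm : 4 * x + 6 != 0 by rewrite gt_eqF//; lra.
  have d1 := is_derive_ln1D Hp.
  have d2 : is_derive x (1 : R) (fun x : R => (4 * x + 6)^-1)
      (- 4 * (4 * x + 6) ^- 2).
    have dg : is_derive x (1 : R) (fun x : R => 4 * x + 6) 4.
      have := is_deriveD (is_deriveZ (4 : R) (is_derive_id x (1 : R)))
        (is_derive_cst (6 : R) x 1).
      by rewrite addr0 /GRing.scale/= mulr1.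
    apply: DeriveDef; first by apply: derivableV => //; exact: ex_derive.
    have dd : derivable (fun x : R => 4 * x + 6) x 1 by exact: ex_derive.
    by rewrite deriveV// derive_val /GRing.scale/= !mulNr mulrC.
  have := is_deriveB (is_deriveB (is_deriveD
    (is_deriveZ (4^-1 : R) (is_derive_id x (1 : R)))
    (is_derive_cst (9 / 8 : R) x 1)) (is_deriveZ (27 / 4 : R) d2)) d1.
  move=> H.
  rewrite (_ : f = (fun x : R => 4^-1 * x + 9 / 8 - 27 / 4 * (4 * x + 6)^-1
      - ln (1 + x))); last first.
    by apply: funext => z; rewrite /f; ring.
  apply: (is_derive_eq H).
  by rewrite /df /GRing.scale/=; field; rewrite ?Hm ?gt_eqF.
have df0 x : 0 <= x <= y -> 0 <= df x.
  move=> /andP[x0 xy]; rewrite /df.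
  have Hp : 0 < 1 + x by lra.
  have Hm : 0 < 4 * x + 6 by lra.
  have -> : 1 / 4 + 27 * (4 * x + 6) ^- 2 - (1 + x)^-1
          = 4 * x ^+ 3 / ((4 * x + 6) ^+ 2 * (1 + x)).
    by field; rewrite !gt_eqF.
  by rewrite divr_ge0 ?mulr_ge0 ?exprn_ge0// ltW.
have := ler_is_derive y0 fdf df0.
by rewrite /f addr0 ln1 mulr0 mul0r !add0r; lra.
Qed.

(** At [u = 1/3] the ratio in [ln_ratio_ge] is 2, and the first term of the series is already
    2/3. *)
Lemma ln2_ge (R : realType) : 2 / 3 <= ln 2 :> R.
Proof.
have h : 0 <= (3^-1 : R) < 1 by apply/andP; split; lra.
have := ln_ratio_ge h; rewrite -ln_div ?posrE; [|lra|lra].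
have -> : (1 + 3^-1) / (1 - 3^-1) = 2 :> R by field.
by apply: le_trans; lra.
Qed.

(** The minimum is close to 1/2, which suggests the decomposition [16/5 (x^2 - 1/4)^2 + 12/5 x (x -
    1/2)^2 + 28/3 (x - 1/2)^2 + x/3 + 1/6]. *)
Lemma dkw_poly (R : realType) (x : R) : 0 <= x ->
  0 <= 27 / 10 - 84 / 10 * x + 16 / 3 * x ^+ 2 + 24 / 10 * x ^+ 3
       + 32 / 10 * x ^+ 4.
Proof.
move=> x0.
have h1 := mulr_ge0 x0 (sqr_ge0 (x - 2^-1)).
have h2 := sqr_ge0 (x ^+ 2 - 4^-1).
have h3 := sqr_ge0 (x - 2^-1).
lra.
Qed.

(** Centring at [m = p + x] turns the log ratio into [2 artanh (x / m)]. As [m <= 1], each term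
    [m (x / m)^k] of the series is at least [x^k], which eliminates [p]; the Pade bound on
    [ln (1 + 2 x)] then leaves [dkw_poly]. *)
Lemma dkw_exponent (R : realType) (p x : R) : 0 < p -> 0 < x -> p + x <= 1 ->
  ln (1 + 2 * x) + 31 / 20 * x ^+ 2 <= (p + x) * (ln (p + 2 * x) - ln p).
Proof.
move=> p0 x0 px1.
set m := p + x; have m0 : 0 < m by rewrite /m; lra.
have m1 : m <= 1 by rewrite /m.
have u01 : 0 <= x / m < 1.
  by rewrite divr_ge0 ?ltW//= ltr_pdivrMr// /m; lra.
have lnE : ln (p + 2 * x) - ln p = ln (1 + x / m) - ln (1 - x / m).
  rewrite -!ln_div ?posrE; try lra.
  by congr ln; rewrite /m; field; rewrite !gt_eqF; lra.
have h1 := ln_ratio_ge u01.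
have h2 : 2 * (x + x ^+ 3 / 3 + x ^+ 5 / 5) <= m * (ln (1 + x / m) - ln (1 - x / m)).
  apply: le_trans (ler_wpM2l (ltW m0) h1).
  have e1 : x ^+ 3 <= m * (x / m) ^+ 3.
    have -> : m * (x / m) ^+ 3 = x ^+ 3 / m ^+ 2 by field; rewrite gt_eqF.
    by rewrite ler_pdivlMr ?exprn_gt0// ler_piMr ?exprn_ge0 ?exprn_ile1// ltW.
  have e2 : x ^+ 5 <= m * (x / m) ^+ 5.
    have -> : m * (x / m) ^+ 5 = x ^+ 5 / m ^+ 4 by field; rewrite gt_eqF.
    by rewrite ler_pdivlMr ?exprn_gt0// ler_piMr ?exprn_ge0 ?exprn_ile1// ltW.
  have e3 : x = m * (x / m) by field; rewrite gt_eqF.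
  lra.
rewrite lnE; apply: le_trans h2.
have h3 := @ln1D_le_pade R (2 * x); have {h3} h3 := h3 ltac:(lra).
apply: (@le_trans _ _ (2 * x / 4 + 9 / 8 - 27 / 4 * (4 * (2 * x) + 6)^-1
  + 31 / 20 * x ^+ 2)); first by rewrite lerD2r.
have q0 : 0 < 4 * (2 * x) + 6 by lra.
rewrite -subr_ge0.
have -> : 2 * (x + x ^+ 3 / 3 + x ^+ 5 / 5) -
    (2 * x / 4 + 9 / 8 - 27 / 4 * (4 * (2 * x) + 6)^-1 + 31 / 20 * x ^+ 2)
  = x ^+ 2 * (27 / 10 - 84 / 10 * x + 16 / 3 * x ^+ 2 + 24 / 10 * x ^+ 3
       + 32 / 10 * x ^+ 4) / (4 * (2 * x) + 6).
  by field; rewrite gt_eqF.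
by rewrite divr_ge0 ?mulr_ge0 ?exprn_ge0 ?dkw_poly// ltW.
Qed.

(** * Crossings on finitely many levels *)

(** This bounds the likelihood ratio [((p + 2 x) / p)^k] at a crossing, multiplied out to admit
    [p = 0]. It is [n] times [dkw_exponent], where [n (p + x)] may be enlarged to [k] because the
    log ratio is nonnegative. *)
Lemma dkw_power_bound (R : realType) (p x : R) (n k : nat) :
  0 <= p -> 0 < x -> (k <= n)%N -> n%:R * (p + x) <= k%:R ->
  p ^+ k * ((1 + 2 * x) ^+ n * expR (31 / 20 * n%:R * x ^+ 2)) <=
  (p + 2 * x) ^+ k.
Proof.
move=> p0 x0 kn npk.
have [n0|n0] := posnP n.
  move: kn; rewrite n0 leqn0 => /eqP ->.
  by rewrite !expr0 mulr0 mul0r expR0 !mulr1.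
have nR0 : 0 < n%:R :> R by rewrite ltr0n.
(* The logarithms need [p > 0]. At [p = 0] a crossing forces [k > 0], and the left side vanishes. *)
have [p_eq0|p_neq0] := eqVneq p 0.
  have k0 : (0 < k)%N.
    rewrite -(ltr0n R); apply: lt_le_trans npk.
    by rewrite mulr_gt0// p_eq0 add0r.
  by rewrite p_eq0 expr0n gtn_eqF// mul0r exprn_ge0// add0r mulr_ge0// ltW.
have {}p0 : 0 < p by rewrite lt0r p_neq0.
have px1 : p + x <= 1.
  by rewrite -(ler_pM2l nR0) mulr1; apply: le_trans npk _; rewrite ler_nat.
have h := dkw_exponent p0 x0 px1.
have P (y : R) (m : nat) : 0 < y -> y ^+ m = expR (m%:R * ln y).
  by move=> y0; rewrite expRM_natl lnK.
rewrite (P p k p0) (P (1 + 2 * x) n) ?(P (p + 2 * x) k); [|lra|lra].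
rewrite -!expRD ler_expR.
have d0 : 0 <= ln (p + 2 * x) - ln p.
  by rewrite subr_ge0 ler_ln ?posrE; lra.
have h1 := ler_wpM2l (ltW nR0) h.
have h2 := ler_wpM2r d0 npk.
lra.
Qed.

Section level_counts.
Context {R : realType} {N : nat} {I : finType}.
Implicit Types (mu : 'I_N.+1 -> R) (i j l : 'I_N.+1) (f : {ffun I -> 'I_N.+1}).

Definition level_mass mu i := \sum_(l : 'I_N.+1 | (l <= i)%N) mu l.

Definition level_count f i := #|[pred t | (f t <= i)%N]|.

(** What is known after reading down to level [i]: points at or below it become indistinguishable,
    while the counts at level [i] and above are kept. *)
Definition clip i l := if (l <= i)%N then i else l.

Definition clip_ffun i f := [ffun t => clip i (f t)].

Definition clip_mass mu i l := \sum_(l' | clip i l' == l) mu l'.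

(** Configurations are grouped by their clipped image; each group is a product over the points, so
    its weight factorizes. *)
Lemma sum_prod_clip mu i (A : pred {ffun I -> 'I_N.+1}) :
  (forall f, A (clip_ffun i f) = A f) ->
  \sum_(f | A f) \prod_t mu (f t) =
  \sum_(f | A f) \prod_t clip_mass mu i (f t).
Proof.
move=> Aclip.
rewrite (partition_big (clip_ffun i) A) => [|f]; last by rewrite Aclip.
apply: eq_bigr => c Ac; rewrite /clip_mass bigA_distr_big_dep.
apply: eq_bigl => f; apply/andP/familyP => [[_ /eqP <- t]|fc].
  by rewrite ffunE unfold_in.
have fE : clip_ffun i f = c.
  by apply/ffunP => t; rewrite ffunE; apply/eqP; exact: fc.
by rewrite -Aclip fE.
Qed.

Lemma clip_mass_gt mu i l : (i < l)%N -> clip_mass mu i l = mu l.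
Proof.
move=> il; rewrite /clip_mass (big_pred1 l)// => l' /=.
rewrite /clip; case: leqP => // l'i; apply/eqP/eqP => E.
  by move: il; rewrite E ltnn.
by move: il; rewrite -E ltnNge l'i.
Qed.

Lemma clip_mass_le mu i l : (l <= i)%N ->
  clip_mass mu i l = if l == i then level_mass mu i else 0.
Proof.
move=> li; rewrite /clip_mass; case: eqP => [->|/eqP lNi].
  apply: eq_bigl => l'; rewrite /clip; case: leqP => [_|il'].
    by rewrite eqxx.
  by apply/eqP => E; rewrite E ltnn in il'.
rewrite big1// => l'; rewrite /clip; case: leqP => [_ /eqP E|il' /eqP E].
  by rewrite E eqxx in lNi.
by move: il'; rewrite E ltnNge li.
Qed.

Lemma clip_mass_ge0 mu i l : (forall l, 0 <= mu l) -> 0 <= clip_mass mu i l.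
Proof. by move=> mu0; apply: sumr_ge0. Qed.

(** Only points at or below [i] tell the two weights apart, each through one factor [level_mass];
    the crosswise form covers masses equal to zero. *)
Lemma prod_clip_mass mu nu i f :
  (forall l, (i < l)%N -> mu l = nu l) ->
  \prod_t clip_mass mu i (f t) * level_mass nu i ^+ level_count f i =
  \prod_t clip_mass nu i (f t) * level_mass mu i ^+ level_count f i.
Proof.
move=> munu.
have cardE (y : R) : y ^+ level_count f i = \prod_(t | (f t <= i)%N) y.
  by rewrite prodr_const; congr (_ ^+ _); apply: eq_card => t; rewrite !inE.
rewrite !cardE (bigID (fun t => (f t <= i)%N))/= mulrAC -big_split/=.
rewrite [in RHS](bigID (fun t => (f t <= i)%N))/= mulrAC -big_split/=.
congr (_ * _); apply: eq_bigr => t.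
  by move=> ti; rewrite !clip_mass_le//; case: ifP; rewrite ?mul0r// mulrC.
by rewrite -ltnNge => it; rewrite !clip_mass_gt// munu.
Qed.

Lemma level_count_clip i j f : (i <= j)%N ->
  level_count (clip_ffun i f) j = level_count f j.
Proof.
move=> ij; apply: eq_card => t; rewrite !inE ffunE /clip.
by case: (leqP (f t) i) => // fti; rewrite ij (leq_trans fti ij).
Qed.

Definition crosses mu (x : R) f i :=
  #|I|%:R * (level_mass mu i + x) <= (level_count f i)%:R.

(** The stopping rule of the downward reading. It depends only on counts from [i] upwards, hence is
    invariant under [clip_ffun]. *)
Definition last_cross mu (x : R) i f :=
  crosses mu x f i && [forall j : 'I_N.+1, (i < j)%N ==> ~~ crosses mu x f j].

Lemma last_cross_clip mu x i f :
  last_cross mu x i (clip_ffun i f) = last_cross mu x i f.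
Proof.
rewrite /last_cross /crosses level_count_clip//; congr (_ && _).
apply: eq_forallb => j; case: ltnP => //= ij.
by rewrite level_count_clip// ltnW.
Qed.

Lemma last_cross_uniq mu x i j f :
  last_cross mu x i f -> last_cross mu x j f -> i = j.
Proof.
move=> /andP[ci /forallP li] /andP[cj /forallP lj].
apply/val_inj/eqP; rewrite eqn_leq; apply/andP; split; rewrite leqNgt.
  by apply/negP => ji; have := lj i; rewrite ji ci.
by apply/negP => ij; have := li j; rewrite ij cj.
Qed.

Lemma crosses_last mu x i f : crosses mu x f i ->
  exists j, last_cross mu x j f.
Proof.
move=> ci; case: (@arg_maxnP _ i (crosses mu x f) val ci) => j cj maxj.
exists j; rewrite /last_cross cj /=; apply/forallP => k; apply/implyP => jk.
by apply/negP => /maxj /= kj; move: jk; rewrite ltnNge; apply/negP/negPn.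
Qed.

(* Adding the mass [2 * x] at the lowest level multiplies the weight of every
   configuration whose last crossing is at a given level by at least
   [expR (31 / 20 * #|I| * x ^ 2) * (1 + 2 * x) ^ #|I|]; the second factor is
   the total weight of all configurations. *)
Lemma sum_crosses_le mu (x : R) : (forall l, 0 <= mu l) ->
  \sum_l mu l = 1 -> 0 < x ->
  \sum_(f : {ffun I -> 'I_N.+1} | [exists i, crosses mu x f i])
     \prod_t mu (f t) <= expR (- (31 / 20 * #|I|%:R * x ^+ 2)).
Proof.
move=> mu0 mu1 x0.
pose nu l := mu l + (2 * x) * (l == ord0)%:R.
have nu0 l : 0 <= nu l by rewrite addr_ge0// mulr_ge0// mulr_ge0// ltW.
have sum_nu : \sum_l nu l = 1 + 2 * x.
  rewrite big_split/= mu1; congr (_ + _).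
  by rewrite (bigD1 ord0)//= mulr1 big1 ?addr0// => l /negPf ->; rewrite mulr0.
have mass_nu i : level_mass nu i = level_mass mu i + 2 * x.
  rewrite /level_mass big_split/=; congr (_ + _).
  rewrite (bigD1 ord0)//= mulr1 big1 ?addr0// => l /andP[_ /negPf ->].
  by rewrite mulr0.
set E := expR (31 / 20 * #|I|%:R * x ^+ 2).
have E0 : 0 < E by exact: expR_gt0.
have T0 : 0 < (1 + 2 * x) ^+ #|I| by rewrite exprn_gt0//; lra.
have step i : \sum_(f | last_cross mu x i f) \prod_t mu (f t) *
    ((1 + 2 * x) ^+ #|I| * E) <= \sum_(f | last_cross mu x i f) \prod_t nu (f t).
  rewrite -mulr_suml (sum_prod_clip mu (last_cross_clip mu x i)).
  rewrite (sum_prod_clip nu (last_cross_clip mu x i)) mulr_suml.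
  apply: ler_sum => f /andP[ci _].
  have m0 : 0 <= level_mass mu i by apply: sumr_ge0.
  have n0 : 0 < level_mass nu i by rewrite mass_nu; lra.
  have kn : (level_count f i <= #|I|)%N by exact: max_card.
  have := dkw_power_bound m0 x0 kn ci; rewrite -/E -mass_nu => pb.
  (* The extra factor [level_mass nu i ^ level_count f i] lets [prod_clip_mass] exchange the weights
     of [mu] for those of [nu]. *)
  rewrite -(ler_pM2r (exprn_gt0 (level_count f i) n0)) mulrAC.
  rewrite (@prod_clip_mass mu nu) => [|l il]; last first.
    by rewrite /nu -val_eqE/= gtn_eqF ?mulr0 ?addr0// (leq_ltn_trans _ il).
  rewrite -mulrA ler_wpM2l// prodr_ge0// => t _; exact: clip_mass_ge0.
have sumI : \sum_(f : {ffun I -> 'I_N.+1}) \prod_t nu (f t) = (1 + 2 * x) ^+ #|I|.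
  by rewrite -(bigA_distr_bigA (fun _ => nu)) sum_nu prodr_const.
rewrite expRN -/E -(ler_pM2r (mulr_gt0 T0 E0)) [leRHS]mulrCA.
rewrite mulVf ?gt_eqF// mulr1 -[leRHS]sumI.
(* A crossing configuration has a last crossing, so it is counted at least once on the [mu] side; by
   uniqueness of the last crossing, none is counted twice on the [nu] side. *)
apply: (@le_trans _ _ (\sum_i \sum_(f | last_cross mu x i f) \prod_t nu (f t))).
  apply: (@le_trans _ _ (\sum_i \sum_(f | last_cross mu x i f)
     \prod_t mu (f t) * ((1 + 2 * x) ^+ #|I| * E))); last by apply: ler_sum.
  rewrite mulr_suml (exchange_big_dep xpredT)//= big_mkcond; apply: ler_sum => f _.
  have W0 : 0 <= \prod_t mu (f t) * ((1 + 2 * x) ^+ #|I| * E).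
    by rewrite mulr_ge0 ?prodr_ge0// ltW// mulr_gt0.
  case: ifPn => [/existsP[i /crosses_last[j lj]]|_]; last by rewrite sumr_ge0.
  by rewrite (bigD1 j)//= lerDl sumr_ge0.
rewrite (exchange_big_dep xpredT)//=; apply: ler_sum => f _.
have W0 : 0 <= \prod_t nu (f t) by rewrite prodr_ge0.
have [[j lj]|none] := pselect (exists j, last_cross mu x j f).
  rewrite (bigD1 j)//= [X in _ + X]big1 ?addr0// => k /andP[lk /eqP]; case.
  exact: last_cross_uniq lk lj.
by rewrite big1// => j lj; exfalso; apply: none; exists j.
Qed.

End level_counts.

(** * Crossings of a chain of events *)

Lemma measure_finType_additive (d : measure_display) (T : measurableType d)
    (R : realType) (mu : {measure set T -> \bar R}) (J : finType) (A : pred J)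
    (F : J -> set T) :
  (forall j, measurable (F j)) -> trivIset setT F ->
  mu [set w | exists2 j, A j & F j w] = (\sum_(j | A j) mu (F j))%E.
Proof.
move=> mF tF.
have -> : [set w | exists2 j, A j & F j w] = \bigcup_(j in [set j | A j]) F j by [].
rewrite measure_fin_bigcup//; [|exact: finite_finset|exact: sub_trivIset tF].
rewrite -(@bigfs _ _ _ _ (index_enum J)) ?index_enum_uniq// => j _.
by rewrite mem_index_enum.
Qed.

Section chain_dkw.
Context {R : realType} {d d' : measure_display}.
Context {Omega : measurableType d} {E : measurableType d'}.
Variables (P : probability Omega R) (I : finType).
Variables (X : I -> Omega -> E) (Z : Omega -> E) (B : nat -> set E).
Hypothesis mX : forall i, measurable_fun setT (X i).
Hypothesis mZ : measurable_fun setT Z.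
Hypothesis mB : forall a, measurable (B a).
Hypothesis chainB : forall a b, B a `<=` B b \/ B b `<=` B a.
Hypothesis XZ : forall i A, measurable A -> P (X i @^-1` A) = P (Z @^-1` A).
Hypothesis Xindep : forall A : I -> set E, (forall i, measurable (A i)) ->
  P [set w | forall i, A i (X i w)] = (\prod_i P (X i @^-1` A i))%E.

Definition hits (a : nat) (w : Omega) : nat := #|[pred i | X i w \in B a]|.

Definition overhit (x : R) (a : nat) : set Omega :=
  [set w | #|I|%:R * (fine (P (Z @^-1` B a)) + x) <= (hits a w)%:R].

(** The events are nested but not listed in order of inclusion. Counting the events missed by [y]
    and, in [chain_rank], those strictly inside [B a] replaces sorting. *)
Definition chain_level (N : nat) (y : E) : nat := \sum_(a < N) (y \notin B a).

Definition chain_rank (N a : nat) : nat :=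
  \sum_(b < N) ~~ `[< B a `<=` B b >].

Lemma chain_level_le N y : (chain_level N y <= N)%N.
Proof.
rewrite -[leqRHS](card_ord N) -sum1_card; apply: leq_sum => a _.
by case: (_ \notin _).
Qed.

Lemma chain_rank_le N a : (chain_rank N a <= N)%N.
Proof.
rewrite -[leqRHS](card_ord N) -sum1_card; apply: leq_sum => b _.
by case: asboolP.
Qed.

(** A point of [B a] misses only events that do not contain [B a]. A point outside misses all events
    strictly inside [B a], and [B a] itself makes the inequality strict. *)
Lemma mem_chain N a y : (a < N)%N ->
  (y \in B a) = (chain_level N y <= chain_rank N a)%N.
Proof.
move=> aN; apply/idP/idP => [ya|].
  apply: leq_sum => b _; case: asboolP => [ab|_]; last by case: (_ \notin _).
  by move: ya; rewrite !inE => /ab yb; rewrite mem_set.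
apply: contraTT => ya; rewrite -ltnNge.
rewrite /chain_level /chain_rank (bigD1 (Ordinal aN))//=.
rewrite [ltnRHS](bigD1 (Ordinal aN))//= ya asboolT// add0n add1n ltnS.
apply: leq_sum => b _; case: asboolP => //= ab.
have [//|ba] := chainB a b.
by case: (boolP (y \in B b)) => // /set_mem/ba yb; rewrite mem_set in ya.
Qed.

Lemma measurable_chain_level N k : measurable [set y | chain_level N y = k].
Proof.
pose g (y : E) : R := \sum_(a < N) \1_(~` B a) y.
have mg : measurable_fun setT g.
  by apply: measurable_sum => a; apply: measurable_indic; exact: measurableC.
have gE y : g y = (chain_level N y)%:R.
  by rewrite /chain_level natr_sum; apply: eq_bigr => a _; rewrite indicE in_setC.
have -> : [set y | chain_level N y = k] = setT `&` g @^-1` [set k%:R].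
  rewrite setTI; apply/seteqP; split=> y /=; rewrite gE; first by move->.
  by move/eqP; rewrite eqr_nat => /eqP.
exact: mg.
Qed.

Lemma measurable_overhit x a : measurable (overhit x a).
Proof.
pose g (w : Omega) : R := \sum_i \1_(X i @^-1` B a) w.
have mXB i : measurable (X i @^-1` B a).
  by rewrite -[X in measurable X]setTI; exact: mX.
have mg : measurable_fun setT g.
  by apply: measurable_sum => i; exact: measurable_indic.
have gE w : g w = (hits a w)%:R.
  rewrite /hits -sum1_card natr_sum big_mkcond; apply: eq_bigr => i _.
  rewrite indicE -[w \in _]/(X i w \in B a) inE.
  by case: (X i w \in B a).
have -> : overhit x a = setT `&` g @^-1` [set y |
    #|I|%:R * (fine (P (Z @^-1` B a)) + x) <= y].
  by rewrite setTI; apply/seteqP; split=> w /=; rewrite /overhit/= gE.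
apply: mg => //; rewrite -set_itvcy; exact: measurable_itv.
Qed.

(** Levels turn the sample into a finite configuration. The disjoint events [C f] fix that
    configuration and have product probabilities, so [sum_crosses_le] applies. *)
Lemma finite_chain_dkw (x : R) N : 0 < x ->
  (P [set w | exists2 a, (a < N)%N & overhit x a w] <=
   (expR (- (31 / 20 * #|I|%:R * x ^+ 2)))%:E)%E.
Proof.
move=> x0.
pose lev (y : E) : 'I_N.+1 := inord (chain_level N y).
have levE y : lev y = chain_level N y :> nat.
  by rewrite inordK// ltnS chain_level_le.
have mlev l : measurable [set y | lev y = l].
  have -> : [set y | lev y = l] = [set y | chain_level N y = l].
    by apply/seteqP; split => y /=; rewrite -levE; [move->|exact: val_inj].
  exact: measurable_chain_level.
have mZl l : measurable (Z @^-1` [set y | lev y = l]).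
  by rewrite -[X in measurable X]setTI; exact: mZ.
have tZl : trivIset setT (fun l => Z @^-1` [set y | lev y = l]).
  by move=> l l' _ _ [w [/= <- <-]].
pose mu (l : 'I_N.+1) : R := fine (P (Z @^-1` [set y | lev y = l])).
have muE l : (mu l)%:E = P (Z @^-1` [set y | lev y = l]).
  by rewrite fineK// fin_num_measure.
have mu0 l : 0 <= mu l by rewrite fine_ge0.
have mu1 : \sum_l mu l = 1.
  apply/EFin_inj; rewrite -sumEFin; under eq_bigr do rewrite muE.
  rewrite -(measure_finType_additive P xpredT mZl tZl) -(probability_setT P).
  by congr (P _); apply/seteqP; split => // w _ /=; exists (lev (Z w)).
have massE i : level_mass mu i = fine (P (Z @^-1` [set y | (lev y <= i)%N])).
  apply/EFin_inj; rewrite -sumEFin; under eq_bigr do rewrite muE.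
  rewrite -(measure_finType_additive P (fun l : 'I_N.+1 => (l <= i)%N) mZl tZl).
  have -> : Z @^-1` [set y | (lev y <= i)%N] =
      [set w | exists2 l : 'I_N.+1, (l <= i)%N & (Z @^-1` [set y | lev y = l]) w].
    apply/seteqP; split => w /=; first by move=> li; exists (lev (Z w)).
    by move=> [l li ->].
  rewrite fineK// fin_num_measure//.
  rewrite [X in measurable X](_ : _ =
    \bigcup_(l in [set l : 'I_N.+1 | (l <= i)%N]) Z @^-1` [set y | lev y = l]) //.
  by apply: fin_bigcup_measurable.
pose C (f : {ffun I -> 'I_N.+1}) : set Omega :=
  [set w | forall i, [set y | lev y = f i] (X i w)].
have mC f : measurable (C f).
  have -> : C f = \big[setI/setT]_(i : I) (X i @^-1` [set y | lev y = f i]).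
    rewrite -bigcap_seq; apply/seteqP; split => w /= h i.
      by move=> _; exact: h.
    by apply: h; rewrite /= mem_index_enum.
  apply: bigsetI_measurable => i _.
  by rewrite -[X in measurable X]setTI; exact: mX.
have tC : trivIset setT C.
  move=> f g _ _ [w [/= hf hg]]; apply/ffunP => i.
  by rewrite -(hf i) -(hg i).
have PC f : P (C f) = (\prod_i mu (f i))%:E.
  rewrite (@Xindep (fun i => [set y | lev y = f i])) => [|i]; last exact: mlev.
  by rewrite -prodEFin; apply: eq_bigr => i _; rewrite XZ// muE.
apply: le_trans (_ : P [set w | exists2 f, [exists i, crosses mu x f i] & C f w]
   <= _)%E; last first.
  rewrite measure_finType_additive//.
  rewrite (eq_bigr (fun f : {ffun I -> 'I_N.+1} => (\prod_i mu (f i))%:E));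
    last by move=> f _; exact: PC.
  by rewrite sumEFin lee_fin sum_crosses_le.
apply: le_measure; rewrite ?inE.
- rewrite [X in measurable X](_ : _ = \bigcup_(a in `I_N) overhit x a)//.
  by apply: bigcup_measurable => a _; exact: measurable_overhit.
- rewrite [X in measurable X](_ : _ =
    \bigcup_(f in [set f | [exists i, crosses mu x f i]]) C f)//.
  by apply: fin_bigcup_measurable.
move=> w [a aN wa] /=; exists [ffun i => lev (X i w)]; last first.
  by move=> i; rewrite ffunE.
have rankK : (inord (chain_rank N a) : 'I_N.+1) = chain_rank N a :> nat.
  by rewrite inordK// ltnS chain_rank_le.
apply/existsP; exists (inord (chain_rank N a)); rewrite /crosses.
have -> : level_mass mu (inord (chain_rank N a)) = fine (P (Z @^-1` B a)).
  rewrite massE rankK; congr (fine (P _)).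
  apply/seteqP; split => v /=; rewrite levE -mem_chain//.
    by move/set_mem.
  by move=> h; rewrite mem_set.
have -> : level_count [ffun i => lev (X i w)] (inord (chain_rank N a)) = hits a w.
  apply: eq_card => i; rewrite !inE ffunE rankK levE -mem_chain//.
exact: wa.
Qed.

(** The finite bound is independent of [N], so it passes to the increasing union. *)
Lemma chain_dkw (x : R) : 0 < x ->
  (P (\bigcup_a overhit x a) <=
   (expR (- (31 / 20 * #|I|%:R * x ^+ 2)))%:E)%E.
Proof.
move=> x0.
pose F N : set Omega := [set w | exists2 a, (a < N)%N & overhit x a w].
have mF N : measurable (F N).
  rewrite [X in measurable X](_ : _ = \bigcup_(a in `I_N) overhit x a)//.
  by apply: bigcup_measurable => a _; exact: measurable_overhit.
have -> : \bigcup_a overhit x a = \bigcup_N F N.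
  apply/seteqP; split => w [a _ wa]; first by exists a.+1 => //; exists a.
  by case: wa => b _ wb; exists b.
have ndF : nondecreasing_seq F.
  move=> m k mk; apply/subsetPset => w [a am wa].
  by exists a => //; exact: leq_trans mk.
have cF := nondecreasing_cvg_mu (mu := P) mF (bigcupT_measurable _ mF) ndF.
rewrite -(cvg_lim _ cF)//; apply: lime_le; first by apply/cvg_ex; eexists; exact: cF.
by apply: nearW => N; exact: finite_chain_dkw.
Qed.

End chain_dkw.

(** * Deterministic regret bound *)

(** Induction over normalized partial sums. A tail of total weight zero cannot be normalized, but
    then all its weights vanish. *)
Lemma convex_comb_in (R : realType) (S : set (R -> R)) (J : finType)
    (w : J -> R) (G : J -> R -> R) :
  (forall F1 F2 (l : R), S F1 -> S F2 -> 0 <= l <= 1 ->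
     S (fun x => l * F1 x + (1 - l) * F2 x)) ->
  (forall j, 0 <= w j) -> \sum_j w j = 1 -> (forall j, S (G j)) ->
  S (fun x => \sum_j w j * G j x).
Proof.
move=> Sconv w0 w1 SG.
have main (r : seq J) : 0 < \sum_(j <- r) w j ->
    S (fun x => (\sum_(j <- r) w j)^-1 * \sum_(j <- r) w j * G j x).
  elim: r => [|j r IH]; first by rewrite big_nil ltxx.
  have [s0|s_neq0] := eqVneq (\sum_(i <- r) w i) 0.
    rewrite big_cons s0 addr0 => wj0.
    have wr i : i \in r -> w i = 0.
      move=> ir; apply/eqP; move/eqP: s0; rewrite psumr_eq0//.
      by move=> /allP/(_ _ ir).
    rewrite (_ : (fun _ => _) = G j)//; apply/funext => x.
    rewrite big_cons big_seq big1 ?addr0 => [|i /wr ->]; last by rewrite mul0r.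
    by rewrite mulKf// gt_eqF.
  have s0 : 0 < \sum_(i <- r) w i by rewrite lt0r s_neq0 sumr_ge0.
  rewrite big_cons => s1.
  set s := \sum_(i <- r) w i in IH s0 s1 s_neq0 *.
  have := Sconv (G j) _ (w j / (w j + s)) (SG j) (IH s0).
  rewrite divr_ge0 ?(ltW s1)//= ler_pdivrMr// mul1r lerDl (ltW s0) => /(_ erefl).
  congr (S _); apply/funext => x; rewrite big_cons.
  by field; rewrite !gt_eqF.
have := main (index_enum J); rewrite w1 ltr01 => /(_ erefl).
by congr (S _); apply/funext => x; rewrite invr1 mul1r.
Qed.

Lemma Dcdf_convex (R : realType) (a b : R) (F G : R -> R) (l : R) :
  Dcdf a b F -> Dcdf a b G -> 0 <= l <= 1 ->
  Dcdf a b (fun x => l * F x + (1 - l) * G x).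
Proof.
move=> [[Fm Fr F0 F1] Fa Fb] [[Gm Gr G0 G1] Ga Gb] /andP[l0 l1].
have cv T (H : set_system T) (f g : T -> R) (u v : R) : Filter H ->
    f @ H --> u -> g @ H --> v ->
    (fun x => l * f x + (1 - l) * g x) @ H --> l * u + (1 - l) * v.
  by move=> FH fu gv; apply: cvgD; apply: cvgM => //; exact: cvg_cst.
split; first split.
- by move=> x y xy; rewrite lerD// ler_wpM2l ?Fm ?Gm// subr_ge0.
- by move=> x; exact: cv.
- by have := cv _ _ _ _ _ _ _ F0 G0; rewrite !mulr0 addr0; apply.
- by have := cv _ _ _ _ _ _ _ F1 G1; rewrite !mulr1 subrKC; apply.
- by have := cv _ _ _ _ _ _ _ Fa Ga; rewrite !mulr0 addr0; apply.
- by rewrite Fb Gb !mulr1 subrKC.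
Qed.

Lemma Dcdf_step (R : realType) (a b c : R) : a <= c <= b ->
  Dcdf a b (fun x => ((c <= x)%R : bool)%:R).
Proof.
move=> /andP[ac cb]; split; first split.
- move=> x y xy; rewrite ler_nat; case: (leP c x) => // cx.
  by rewrite (le_trans cx xy).
- move=> x; apply: cvg_near_cst; case: (leP c x) => cx; near=> y.
    have xy : x < y by near: y; exact: nbhs_right_gt.
    by rewrite (le_trans cx (ltW xy)).
  have yc : y < c by near: y; exact: nbhs_right_lt.
  by rewrite leNgt yc.
- apply: cvg_near_cst; near=> y.
  have yc : y < c by near: y; apply: nbhs_ninfty_lt; exact: num_real.
  by rewrite leNgt yc.
- apply: cvg_near_cst; near=> y.
  have -> // : c <= y by near: y; apply: nbhs_pinfty_ge; exact: num_real.
- apply: cvg_near_cst; near=> y.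
  have yc : y < c by apply: lt_le_trans ac; near: y; exact: nbhs_left_lt.
  by rewrite leNgt yc.
- by rewrite cb.
Unshelve. all: by end_near. Qed.

Lemma is_cdf_bounds (R : realType) (F : R -> R) (x : R) :
  is_cdf F -> 0 <= F x <= 1.
Proof.
move=> [Fm _ F0 F1]; apply/andP; split.
  rewrite -(cvg_lim _ F0)//; apply: limr_le.
    by apply/cvg_ex; eexists; exact: F0.
  by near=> y; apply: Fm; near: y; apply: nbhs_ninfty_le; exact: num_real.
rewrite -(cvg_lim _ F1)//; apply: limr_ge; first by apply/cvg_ex; eexists; exact: F1.
by near=> y; apply: Fm; near: y; apply: nbhs_pinfty_ge; exact: num_real.
Unshelve. all: by end_near. Qed.

Lemma supnorm_le (R : realType) (F G : R -> R) (c : R) :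
  (forall x, `|F x - G x| <= c) -> supnorm F G <= c.
Proof.
move=> FG; apply: ge_sup; first by exists `|F 0 - G 0|, 0.
by move=> _ [x _ <-].
Qed.

(** * Lexicographic minima and maximizers over finite sets *)

Section lexicographic.
Context {R : realType} {K : nat}.
Implicit Types d : 'rV[R]_K.

Lemma lexlt_total d d' : d <> d' -> lexlt d d' \/ lexlt d' d.
Proof.
move=> dd'; have [i0 i0P] : exists i, d ord0 i != d' ord0 i.
  apply: contrapT => /forallNP h; apply: dd'; apply/rowP => i.
  by apply/eqP; have /negP := h i; rewrite negbK.
case: (@arg_minnP _ i0 (fun i => d ord0 i != d' ord0 i) val i0P) => i iP imin.
have eq_lt (j : 'I_K) : (j < i)%N -> d ord0 j = d' ord0 j.
  move=> ji; apply/eqP; apply: contraTT ji => /imin ij.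
  by rewrite -leqNgt.
have [lt|lt|eq] := ltgtP (d ord0 i) (d' ord0 i).
- by left; exists i.
- by right; exists i; split => // j /eq_lt.
- by rewrite eq eqxx in iP.
Qed.

Lemma lexlt_trans d1 d2 d3 : lexlt d1 d2 -> lexlt d2 d3 -> lexlt d1 d3.
Proof.
move=> [i [ei li]] [j [ej lj]].
have [ij|ji|ij] := ltngtP i j.
- exists i; split; last by rewrite -ej.
  by move=> k ki; rewrite ei// ej// (ltn_trans ki).
- exists j; split; last by rewrite ei.
  by move=> k kj; rewrite ei ?ej// (ltn_trans kj).
- move/val_inj: ij => ij; subst j; exists i; split; last exact: lt_trans lj.
  by move=> k ki; rewrite ei// ej.
Qed.

(** Since [lexmin] defaults to [0], the point is that a minimum exists: induction on an enumeration
    of [S], by totality and transitivity of the order. *)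
Lemma lexmin_in (S : set 'rV[R]_K) : finite_set S -> S !=set0 -> S (lexmin S).
Proof.
move=> /finite_seqP[s ->] [d0 d0s].
have ne : s != [::] by apply/eqP => E; move: d0s; rewrite E.
suff ex : exists d, lexmin_set [set` s] d.
  by rewrite /lexmin; case: xgetP => [d _ []//|none]; case: ex => d /none.
elim: s ne {d0 d0s} => // d s IH _.
have [->|ne] := eqVneq s [::].
  exists d; split => [|d']; first by rewrite /= inE.
  by rewrite /= inE => /eqP ->.
have {IH} [e [es emin]] := IH ne.
have [de|de] := eqVneq d e.
  exists e; split => [|d']; first by rewrite /= inE es orbT.
  rewrite /= inE => /orP[/eqP ->|d's]; last exact: emin.
  by move=> /(_ de).
have [lt|lt] := lexlt_total (elimN eqP de).
  exists d; split => [|d']; first by rewrite /= inE eqxx.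
  rewrite /= inE => /orP[/eqP -> //|d's] _.
  have [->//|d'e] := eqVneq d' e.
  by apply: lexlt_trans lt _; apply: emin => //; exact/eqP.
exists e; split => [|d']; first by rewrite /= inE es orbT.
by rewrite /= inE => /orP[/eqP -> //|d's]; exact: emin.
Qed.

Lemma argmax_nonempty (T : (R -> R) -> R) (S : set 'rV[R]_K)
    (G : 'I_K -> R -> R) :
  finite_set S -> S !=set0 -> argmaxset T S G !=set0.
Proof.
move=> /finite_seqP[s ->] [d0 d0s].
have ne : s != [::] by apply/eqP => E; move: d0s; rewrite E.
elim: s ne {d0 d0s} => // d s IH _.
have [->|ne] := eqVneq s [::].
  exists d; split => [|d']; first by rewrite /= inE.
  by rewrite /= inE => /eqP ->.
have {IH} [e [es emax]] := IH ne.
have [le|/ltW le] := leP (T (mix d G)) (T (mix e G)).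
  exists e; split => [|d']; first by rewrite /= inE es orbT.
  by rewrite /= inE => /orP[/eqP ->//|]; exact: emax.
exists d; split => [|d']; first by rewrite /= inE eqxx.
by rewrite /= inE => /orP[/eqP ->//|/emax]; move=> h; exact: le_trans le.
Qed.

End lexicographic.

(** * Regret under a uniform bound on the deviations *)

Section regret_bound.
Context {R : realType} {K n : nat} (a b C : R).
Context (D : set (R -> R)) (T : (R -> R) -> R) (M Mn : set 'rV[R]_K).
Context (Pi : 'I_K -> {set 'I_n}) (F : 'I_K -> R -> R).
Hypothesis DDcdf : D `<=` Dcdf a b.
Hypothesis Dconv : forall F G (l : R), D F -> D G -> 0 <= l <= 1 ->
  D (fun x => l * F x + (1 - l) * G x).
Hypothesis C0 : 0 < C.
Hypothesis Tlip : forall F G, D F -> Dcdf a b G -> `|T F - T G| <= C * supnorm F G.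
Hypothesis Msimplex : M `<=` simplex (R:=R) (K:=K).
Hypothesis MnM : Mn `<=` M.
Hypothesis Mn0 : Mn !=set0.
Hypothesis Mnfin : finite_set Mn.
Hypothesis Pi0 : forall j, (0 < #|Pi j|)%N.
Hypothesis DF : forall i, D (F i).

Lemma mix_in (S : set (R -> R)) (d : 'rV[R]_K) (G : 'I_K -> R -> R) :
  (forall F1 F2 (l : R), S F1 -> S F2 -> 0 <= l <= 1 ->
     S (fun x => l * F1 x + (1 - l) * F2 x)) ->
  simplex d -> (forall j, S (G j)) -> S (mix d G).
Proof.
move=> Sconv [d0 d1] SG; apply: convex_comb_in => // j.
by have /andP[] := d0 j.
Qed.

Lemma ecdf_Dcdf (y : nat -> K.-tuple R) j :
  (forall (t : 'I_n) i, a <= tnth (y t) i <= b) ->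
  Dcdf a b (ecdf_SA Pi y j).
Proof.
move=> yab; have m0 : 0 < #|Pi j|%:R :> R by rewrite ltr0n Pi0.
pose J := {t : 'I_n | t \in Pi j}.
have -> : ecdf_SA Pi y j = (fun x => \sum_(t : J) #|Pi j|%:R^-1 *
    ((tnth (y (val t)) j <= x)%R : bool)%:R).
  apply/funext => x; rewrite /ecdf_SA mulr_sumr.
  by rewrite (big_sub (mem (Pi j))).
apply: (@convex_comb_in _ (Dcdf a b) J) => [F1 F2 l h1 h2|t||t].
- exact: Dcdf_convex.
- by rewrite invr_ge0 ltW.
- by rewrite sumr_const card_sig -[LHS]mulr_natr mulVf// gt_eqF.
- exact: Dcdf_step.
Qed.

(** Two cdfs differ by at most 1 everywhere. This bounds the sets whose [sup] defines [optval] and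
    [opt_error]; on an unbounded set [sup] is only a default value. *)
Lemma T_dist_le1 F1 G : D F1 -> Dcdf a b G -> `|T F1 - T G| <= C.
Proof.
move=> DF1 DG; apply: le_trans (Tlip DF1 DG) _.
rewrite -[leRHS]mulr1 ler_pM2l//; apply: supnorm_le => x.
have /andP[f0 f1] := is_cdf_bounds x (let: And3 h _ _ := DDcdf DF1 in h).
have /andP[g0 g1] := is_cdf_bounds x (let: And3 h _ _ := DG in h).
by rewrite ler_norml; lra.
Qed.

Lemma optval_dist (S : set 'rV[R]_K) (G : 'I_K -> R -> R) F1 :
  S `<=` M -> S !=set0 -> D F1 -> (forall i, D (G i)) ->
  `|T F1 - optval T S G| <= C.
Proof.
move=> SM [d0 Sd0] DF1 DG.
have H d : S d -> `|T F1 - T (mix d G)| <= C.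
  move=> Sd; apply: T_dist_le1 => //; apply: DDcdf; apply: mix_in => //.
  exact/Msimplex/SM.
have H2 d : S d -> T F1 - C <= T (mix d G) <= T F1 + C.
  by move=> /H; rewrite ler_norml => /andP[h1 h2]; apply/andP; split; lra.
have ub : ubound [set T (mix d G) | d in S] (T F1 + C).
  by move=> _ [d Sd <-]; have /andP[] := H2 _ Sd.
have le : optval T S G <= T F1 + C.
  by apply: ge_sup => //; exists (T (mix d0 G)), d0.
have ge : T F1 - C <= optval T S G.
  have /andP[h _] := H2 _ Sd0; apply: le_trans h _.
  by apply: ub_le_sup; [exists (T F1 + C)|exists d0].
by rewrite ler_norml; lra.
Qed.

Lemma opt_error_ge (G : 'I_K -> R -> R) : (forall i, D (G i)) -> D !=set0 ->
  `|optval T M G - optval T Mn G| <= opt_error T D M Mn.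
Proof.
move=> DG [F1 DF1]; apply: ub_le_sup; last by exists G.
exists (C + C) => _ [G' DG' <-].
have M0 : M !=set0 by case: Mn0 => d /MnM; exists d.
have h1 := optval_dist (fun _ => id) M0 DF1 DG'.
have h2 := optval_dist MnM Mn0 DF1 DG'.
apply: le_trans (lerD h1 h2); rewrite [in leRHS]distrC.
by rewrite -[X in `|X|](subrKA (T F1)) ler_normD.
Qed.

(** As the weights sum to 1, passing from [F] to the empirical cdfs changes each value of [T] by at
    most [C * dlt]. This is paid once at the recommendation and once at its competitor in [Mn];
    [opt_error] pays for passing from [Mn] to [M]. *)
Lemma SA_regret_le (y : nat -> K.-tuple R) (dlt : R) :
  (forall (t : 'I_n) i, a <= tnth (y t) i <= b) -> D !=set0 ->
  (forall j x, `|F j x - ecdf_SA Pi y j x| <= dlt) ->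
  SA_regret T M Mn Pi F y <= opt_error T D M Mn + 2 * C * dlt.
Proof.
move=> yab D0 close; set e := ecdf_SA Pi y in close *.
have TL d : M d -> `|T (mix d F) - T (mix d e)| <= C * dlt.
  move=> Md; have sd := Msimplex Md; have [d01 d1] := sd.
  have d0 i : 0 <= d ord0 i by have /andP[] := d01 i.
  have Dd : D (mix d F) by apply: mix_in.
  have De : Dcdf a b (mix d e).
    by apply: mix_in => // [F1 F2 l|j]; [exact: Dcdf_convex|exact: ecdf_Dcdf].
  apply: le_trans (Tlip Dd De) _; rewrite ler_pM2l//; apply: supnorm_le => x.
  rewrite /mix -sumrB; apply: le_trans (ler_norm_sum _ _ _) _.
  rewrite -[leRHS]mul1r -d1 mulr_suml; apply: ler_sum => i _.
  by rewrite -mulrBr normrM ger0_norm// ler_wpM2l.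
have := lexmin_in (sub_finite_set _ Mnfin) (argmax_nonempty T e Mnfin Mn0).
move=> /(_ (fun d h => h.1))[]; rewrite -/(SA_recommendation T Mn Pi y).
set r := SA_recommendation T Mn Pi y => Mnr rmax.
have opt_le : optval T Mn F <= T (mix r F) + 2 * C * dlt.
  apply: ge_sup; first by case: Mn0 => d Md; exists (T (mix d F)), d.
  move=> _ [d Md <-]; have := TL _ (MnM Md); have := TL _ (MnM Mnr).
  by have := rmax _ Md; rewrite !ler_norml; lra.
have := opt_error_ge DF D0; rewrite ler_norml /SA_regret -/r; lra.
Qed.

End regret_bound.

(** * Deviations of the empirical cdfs *)

Section integral_upper_bound.
Context {d : measure_display} {Omega : measurableType d} {R : realType}.
Variable P : probability Omega R.
Import HBNNSimple.

(* The integral of a nonnegative function is a supremum over the simple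
   functions below it, so that [f] need not be measurable. *)
Lemma integral_le_simple (f : Omega -> R) (c h : R) (U : nat -> set Omega)
    (p : nat -> R) (N : nat) :
  0 <= c -> 0 <= h -> (forall k, measurable (U k)) ->
  (forall k, (P (U k) <= (p k)%:E)%E) ->
  {ae P, forall w, f w <= c + h * \sum_(k < N) \1_(U k) w} ->
  (\int[P]_w (f w)%:E <= (c + h * \sum_(k < N) p k)%:E)%E.
Proof.
move=> c0 h0 mU Up aef.
pose g (w : Omega) : R := c + h * \sum_(k < N) \1_(U k) w.
have s0 w : 0 <= \sum_(k < N) (\1_(U k) w : R) by rewrite sumr_ge0.
have g0 w : 0 <= g w by rewrite addr_ge0// mulr_ge0.
have ms : measurable_fun setT (fun w => \sum_(k < N) \1_(U k) w : R).
  by apply: measurable_sum => k; exact: measurable_indic.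
have mg : measurable_fun setT g.
  by apply: measurable_funD => //; apply: measurable_funM.
have Ig : (\int[P]_w (g w)%:E <= (c + h * \sum_(k < N) p k)%:E)%E.
  under eq_integral do rewrite /g EFinD EFinM.
  rewrite ge0_integralD//; last 2 first.
  - by move=> w _; rewrite -EFinM lee_fin mulr_ge0.
  - by apply/measurable_EFinP; apply: measurable_funM.
  rewrite integral_cst//= probability_setT mule1 EFinD leeD2l//.
  rewrite ge0_integralZl//; last 2 first.
  - exact/measurable_EFinP.
  - by move=> w _; rewrite lee_fin.
  rewrite EFinM lee_wpmul2l ?lee_fin//.
  under eq_integral do rewrite -sumEFin.
  rewrite ge0_integral_sum//; last first.
    by move=> k; apply/measurable_EFinP; exact: measurable_indic.
  rewrite -[leRHS]sumEFin; apply: lee_sum => k _.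
  by rewrite integral_indic// setIT; exact: Up.
(* The function [f] may be negative; dropping its negative part only increases the integral. *)
apply: le_trans Ig; rewrite integralE.
apply: (@le_trans _ _ (\int[P]_w ((EFin \o f) ^\+ w))%E).
  by rewrite -[leRHS]sube0 leeB// integral_ge0// => w _; exact: funeneg_ge0.
rewrite ge0_integralTE//; apply: ge_ereal_sup => _ [s sf <-].
have -> : sintegral P s = (\int[P]_w (s w)%:E)%E.
  by rewrite integral_nnsfun// patch_setT.
apply: ae_ge0_le_integral => //.
- by move=> w _; rewrite lee_fin.
- exact/measurable_EFinP.
- by move=> w _; rewrite lee_fin.
- exact/measurable_EFinP.
apply: filterS aef => w fg _; apply: le_trans (sf w) _.
by rewrite funeposE ge_max !lee_fin fg g0.
Qed.

End integral_upper_bound.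

(** * Samples of the arms and their two tails *)

Section iid_arms.
Context {R : realType} {K n : nat} {dsp : measure_display}.
Context {Omega : measurableType dsp} (P : probability Omega R).
Context (Y : nat -> Omega -> K.-tuple R) (Pi : 'I_K -> {set 'I_n}).
Context (F : 'I_K -> R -> R) (a b : R).
Hypothesis iidY : iid_vectors P Y.
Hypothesis cdfY : forall t i x,
  P [set w | tnth (Y t w) i <= x] = (F i x)%:E.
Hypothesis DF : forall i, Dcdf a b (F i).
Hypothesis Pi0 : forall j, (0 < #|Pi j|)%N.

Let mY t : measurable_fun setT (Y t). Proof. by case: iidY. Qed.

(** Independence is given along sequences of natural numbers; the events are transported along
    [idx], with the whole space at indices outside its image. *)
Lemma iid_indep (I : finType) (idx : I -> nat) (A : I -> set (K.-tuple R)) :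
  injective idx -> (forall i, measurable (A i)) ->
  P [set w | forall i, A i (Y (idx i) w)] =
  (\prod_i P (Y (idx i) @^-1` A i))%E.
Proof.
move=> idx_inj mA; case: iidY => _ _ indep.
pose A' k := if [pick i | idx i == k] is Some i then A i else setT.
have A'E i : A' (idx i) = A i.
  rewrite /A'; case: pickP => [i' /eqP/idx_inj -> //|/(_ i)].
  by rewrite eqxx.
have mA' k : measurable (A' k) by rewrite /A'; case: pickP.
have us : uniq (map idx (index_enum I)).
  by rewrite map_inj_uniq// index_enum_uniq.
have := indep _ _ us mA'; rewrite !big_map => H.
transitivity (P (\big[setI/setT]_(i : I) (Y (idx i) @^-1` A' (idx i)))).
  congr (P _); rewrite -bigcap_seq; apply/seteqP; split => w /= h i.
    by move=> _; rewrite /= A'E; exact: h.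
  by rewrite -A'E; apply: h; rewrite /= mem_index_enum.
by rewrite H; apply: eq_bigr => i _; rewrite A'E.
Qed.

Let arm j := {t : 'I_n | t \in Pi j}.

Let Xarm j (t : arm j) (w : Omega) := Y (val t) w.

(** Reaches every rational; a number that codes none gives [0], which merely repeats a level. *)
Let rat_enum (k : nat) : R := ratr (odflt 0 (unpickle k)).

Let lower j (k : nat) : set (K.-tuple R) := [set v | tnth v j <= rat_enum k].

(** An overhit of this chain of complements means that the empirical cdf is too small, an overhit of
    [lower] that it is too large. *)
Let upper j (k : nat) : set (K.-tuple R) := [set v | rat_enum k < tnth v j].

Let mlower j k : measurable (lower j k).
Proof.
have -> : lower j k = setT `&` (fun v => tnth v j) @^-1` `]-oo, rat_enum k].
  by rewrite setTI; apply/seteqP; split => v /=; rewrite in_itv.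
by apply: measurable_tnth => //; exact: measurable_itv.
Qed.

Let upperE j k : upper j k = ~` lower j k.
Proof.
by apply/seteqP; split => v; rewrite /upper /lower/= ltNge => /negP.
Qed.

Let mupper j k : measurable (upper j k).
Proof. by rewrite upperE; exact: measurableC. Qed.

(* By right continuity it is enough to compare the cdfs at rational points,
   which makes the event measurable. *)
Definition deviates j (x : R) : set Omega :=
  \bigcup_k overhit P (Xarm (j := j)) (Y 0) (lower j) x k `|`
  \bigcup_k overhit P (Xarm (j := j)) (Y 0) (upper j) x k.

Let mXarm j (t : arm j) : measurable_fun setT (Xarm t).
Proof. exact: mY. Qed.

Lemma measurable_deviates j x : measurable (deviates j x).
Proof.
by apply: measurableU; apply: bigcupT_measurable => k; exact: measurable_overhit.
Qed.

Lemma deviates_prob j x : 0 < x ->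
  (P (deviates j x) <= (2 * expR (- (31 / 20 * #|Pi j|%:R * x ^+ 2)))%:E)%E.
Proof.
move=> x0.
have card_arm : #|{: arm j}| = #|Pi j| by rewrite card_sig.
have XZ (t : arm j) A : measurable A -> P (Xarm t @^-1` A) = P (Y 0 @^-1` A).
  by case: iidY => _ + _; exact.
have indep (A : arm j -> set (K.-tuple R)) : (forall t, measurable (A t)) ->
    P [set w | forall t, A t (Xarm t w)] = (\prod_t P (Xarm t @^-1` A t))%E.
  by apply: iid_indep => t t' /val_inj/val_inj.
have dkw (B : nat -> set (K.-tuple R)) : (forall k, measurable (B k)) ->
    (forall k l, B k `<=` B l \/ B l `<=` B k) ->
    (P (\bigcup_k overhit P (Xarm (j := j)) (Y 0) B x k) <=
     (expR (- (31 / 20 * #|Pi j|%:R * x ^+ 2)))%:E)%E.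
  by move=> mB cB; rewrite -card_arm; apply: chain_dkw.
rewrite mulr_natl mulr2n EFinD.
apply: (@le_trans _ _ (P (\bigcup_k overhit P (Xarm (j := j)) (Y 0) (lower j) x k)
  + P (\bigcup_k overhit P (Xarm (j := j)) (Y 0) (upper j) x k))%E).
  apply: measureU2; apply: bigcupT_measurable => k; exact: measurable_overhit.
apply: leeD; apply: dkw => // k l; case: (leP (rat_enum k) (rat_enum l)) => kl.
- by left => v /= h; exact: le_trans kl.
- by right => v /= h; exact: le_trans (ltW kl).
- by right => v /=; exact: le_lt_trans.
- by left => v /=; exact: lt_trans.
Qed.

Let mem_lower j k v : (v \in lower j k) = (tnth v j <= rat_enum k).
Proof. by apply/idP/idP; rewrite inE. Qed.

Let hits_lower j k w : (hits (Xarm (j := j)) (lower j) k w)%:R =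
  #|Pi j|%:R * ecdf_SA Pi (fun t => Y t w) j (rat_enum k).
Proof.
rewrite /ecdf_SA mulVKf; last by rewrite pnatr_eq0 -lt0n Pi0.
rewrite /hits -sum1_card natr_sum big_mkcond/= (big_sub (mem (Pi j))).
apply: eq_bigr => t _.
by rewrite !inE mem_lower /Xarm; case: leP.
Qed.

Let hits_upper j k w : (hits (Xarm (j := j)) (upper j) k w)%:R =
  #|Pi j|%:R * (1 - ecdf_SA Pi (fun t => Y t w) j (rat_enum k)).
Proof.
rewrite mulrBr -hits_lower mulr1; apply/eqP; rewrite eq_sym subr_eq -natrD eqr_nat.
have <- : #|{: arm j}| = #|Pi j| by rewrite card_sig.
rewrite /hits -(cardC [pred t : arm j | Xarm t w \in lower j k]) addnC.
apply/eqP; congr (_ + _)%N; apply: eq_card => t.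
by rewrite !inE upperE in_setC.
Qed.

(** A relative frequency is at most 1. This makes the sum over thresholds in the theorem finite. *)
Lemma deviates_gt1 j x : 1 < x -> deviates j x = set0.
Proof.
move=> x1; have card_arm : #|{: arm j}| = #|Pi j| by rewrite card_sig.
have over B k w : ~ overhit P (Xarm (j := j)) (Y 0) B x k w.
  rewrite /overhit /= card_arm; apply/negP; rewrite -ltNge.
  apply: (@le_lt_trans _ _ #|Pi j|%:R).
    by rewrite ler_nat -card_arm; exact: max_card.
  rewrite -[ltLHS]mulr1 ltr_pM2l ?ltr0n ?Pi0//.
  by rewrite (lt_le_trans x1)// lerDr fine_ge0.
by apply/seteqP; split => // w [] [k _ /over].
Qed.

Lemma not_deviates j x w y :
  (forall (t : 'I_n) i, a <= tnth (Y t w) i <= b) -> ~ deviates j x w ->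
  `|F j y - ecdf_SA Pi (fun t => Y t w) j y| <= x.
Proof.
move=> wab ndev; set e := ecdf_SA Pi (fun t => Y t w) j.
have [[_ Fr _ _] _ _] := DF j.
have [[_ er _ _] _ _] : Dcdf a b e by apply: ecdf_Dcdf.
have card_arm : #|{: arm j}| = #|Pi j| by rewrite card_sig.
have m0 : 0 < #|Pi j|%:R :> R by rewrite ltr0n.
have mYl k : measurable (Y 0 @^-1` lower j k).
  by rewrite -[X in measurable X]setTI; exact: mY.
have Plower k : P (Y 0 @^-1` lower j k) = (F j (rat_enum k))%:E by exact: cdfY.
have Pupper k : P (Y 0 @^-1` upper j k) = (1 - F j (rat_enum k))%:E.
  rewrite upperE preimage_setC probability_setC; last exact: mYl.
  rewrite EFinB.
  by congr (_ - _)%E; exact: Plower.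
have close k : `|F j (rat_enum k) - e (rat_enum k)| <= x.
  have low : ~ (#|Pi j|%:R * (F j (rat_enum k) + x) <=
      #|Pi j|%:R * e (rat_enum k)).
    move=> h; apply: ndev; left; exists k => //.
    by rewrite /overhit /mkset card_arm hits_lower Plower.
  have upp : ~ (#|Pi j|%:R * (1 - F j (rat_enum k) + x) <=
      #|Pi j|%:R * (1 - e (rat_enum k))).
    move=> h; apply: ndev; right; exists k => //.
    by rewrite /overhit /mkset card_arm hits_upper Pupper.
  move: low upp; rewrite !ler_pM2l//.
  move=> /negP; rewrite -ltNge => h1 /negP; rewrite -ltNge => h2.
  by rewrite ler_norml; apply/andP; split; lra.
(* A strict violation at [y] persists just to the right of [y], where there is a rational. *)
rewrite leNgt; apply/negP => xlt.
have cFe : F j z - e z @[z --> y^'+] --> F j y - e y.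
  by apply: cvgB; [exact: Fr|exact: er].
have := cvgr_gt _ (cvg_norm cFe) _ xlt.
move=> [r /= r0 hr].
have yr : y < y + r by rewrite ltrDl.
have [q] := rat_in_itvoo yr; rewrite in_itv/= => /andP[yq qr].
have qE : rat_enum (pickle q) = ratr q by rewrite /rat_enum pickleK.
have : x < `|F j (ratr q) - e (ratr q)|.
  by apply: hr => //=; rewrite ltr0_norm ?subr_lt0// opprB ltrBlDl.
by rewrite -qE ltNge close.
Qed.

(** No mass lies below [a], where the monotone [F i] has left limit [0], and none above [b], where
    [F i b = 1]. *)
Lemma sample_ae : {ae P, forall w, forall (t : 'I_n) i,
  a <= tnth (Y t w) i <= b}.
Proof.
apply: filter_forall => t; apply: filter_forall => i.
have mle x : measurable [set w | tnth (Y t w) i <= x].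
  have -> : [set w | tnth (Y t w) i <= x] =
      setT `&` Y t @^-1` ((fun v => tnth v i) @^-1` `]-oo, x]).
    by rewrite setTI; apply/seteqP; split => w /=; rewrite in_itv.
  apply: mY => //; rewrite -[X in measurable X]setTI.
  by apply: measurable_tnth => //; exact: measurable_itv.
have [Fi Fa Fb] := DF i; have [Fm _ _ _] := Fi.
have F0 x : x < a -> F i x = 0.
  move=> xa; apply/eqP; rewrite eq_le; have /andP[-> _] := is_cdf_bounds x Fi.
  rewrite andbT -(cvg_lim _ Fa)//; apply: limr_ge.
    by apply/cvg_ex; eexists; exact: Fa.
  by near=> y; apply: Fm; near: y; exact: nbhs_left_ge.
have lo : {ae P, forall w, a <= tnth (Y t w) i}.
  apply: (@negligibleS _ _ _ P
    (\bigcup_k [set w | tnth (Y t w) i <= a - k.+1%:R^-1])).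
    move=> w /= /negP; rewrite -ltNge => wa.
    have /ltr_add_invr[k hk] : tnth (Y t w) i < a by [].
    by exists k => //=; rewrite lerBrDr ltW.
  apply: negligible_bigcup => k; apply/negligibleP => //.
  by apply: etrans (cdfY t i _) _; rewrite F0// ltrBlDr ltrDl invr_gt0.
have hi : {ae P, forall w, tnth (Y t w) i <= b}.
  apply/negligibleP; first exact: measurableC.
  apply: etrans (probability_setC P (mle b)) _.
  by rewrite [P _](cdfY t i b) Fb subee.
by apply: filterS2 lo hi => w -> ->.
Unshelve. all: by end_near. Qed.

End iid_arms.

(** * The mean of the maximal deviation *)

Lemma beta_n_le (K n : nat) (Pi : 'I_K -> {set 'I_n}) (j : 'I_K) :
  (beta_n Pi <= #|Pi j|)%N.
Proof.
rewrite /beta_n; have := mem_index_enum j; elim: (index_enum _) => // i r IH.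
rewrite inE big_cons => /orP[/eqP ->|/IH]; first exact: geq_minl.
by move=> h; apply: leq_trans h; exact: geq_minr.
Qed.

Lemma beta_n_gt0 (K n : nat) (Pi : 'I_K -> {set 'I_n}) : (0 < n)%N ->
  (forall j, (0 < #|Pi j|)%N) -> (0 < beta_n Pi)%N.
Proof.
move=> n0 Pi0; apply: (big_ind (fun m => 0 < m)%N) => // x y x0 y0.
by rewrite leq_min x0.
Qed.

Lemma measure_bigsetU_le (d : measure_display) (T : measurableType d)
    (R : realType) (mu : {measure set T -> \bar R}) (J : Type) (s : seq J)
    (A : J -> set T) : (forall j, measurable (A j)) ->
  (mu (\big[setU/set0]_(j <- s) A j) <= \sum_(j <- s) mu (A j))%E.
Proof.
move=> mA; elim: s => [|j s IH]; first by rewrite !big_nil measure0.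
have ms : measurable (\big[setU/set0]_(i <- s) A i).
  exact: bigsetU_measurable.
rewrite !big_cons; apply: le_trans (measureU2 mu (mA j) ms) _.
by rewrite leeD2l.
Qed.

(** An upper Riemann sum exceeds the integral [lam^-1] of [expR (- (lam * y))] over the half-line by
    at most one step. For the geometric ratio [q] this amounts to [q (1 + lam h) <= 1], from
    [1 + t <= expR t]. *)
Lemma expR_geometric_le (R : realType) (lam h : R) (N : nat) :
  0 < lam -> 0 < h ->
  h * \sum_(k < N) expR (- (lam * (k%:R * h))) <= h + lam^-1.
Proof.
move=> lam0 h0; set q := expR (- (lam * h)).
have u0 : 0 < lam * h by rewrite mulr_gt0.
have q1 : q < 1 by rewrite expR_lt1 oppr_lt0.
have -> : \sum_(k < N) expR (- (lam * (k%:R * h))) = \sum_(k < N) q ^+ k.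
  by apply: eq_bigr => k _; rewrite -expRM_natl; congr expR; ring.
have qle : q * (1 + lam * h) <= 1.
  by rewrite /q expRN mulrC ler_pdivrMr ?expR_gt0// mul1r expR_ge1Dx.
have hle : h <= (h + lam^-1) * (1 - q).
  have -> : (h + lam^-1) * (1 - q) = (1 + lam * h - q * (1 + lam * h)) / lam.
    by field; rewrite gt_eqF.
  by rewrite ler_pdivlMr//; lra.
apply: le_trans (ler_wpM2r _ hle) _.
  by rewrite sumr_ge0// => k _; rewrite exprn_ge0// expR_ge0.
rewrite -mulrA -opprB mulNr -subrX1 opprB -[leRHS]mulr1 ler_wpM2l//.
  by apply: addr_ge0; rewrite ?invr_ge0 ltW.
by rewrite gerBl exprn_ge0// expR_ge0.
Qed.

(** The constant 3.01 is decided here: by [ln 2 <= L] and [1 <= 3/2 L] the left side is at most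
    [70/31 L], just below [(301/200)^2 L]. *)
Lemma step_slack_gt0 (R : realType) (L : R) : ln 2 <= L ->
  (ln 2 + L) / (31 / 20) + (31 / 20)^-1 < (301 / 200) ^+ 2 * L.
Proof. by move=> h; have := ln2_ge R; lra. Qed.

Theorem theorem4p1
  (R : realType) (a b : R) (K : nat) (D : set (R -> R)) (T : (R -> R) -> R)
  (C : R) (M : set 'rV[R]_K) (n : nat) (Pi : 'I_K -> {set 'I_n})
  (Mn : set 'rV[R]_K) :
  a < b -> (2 <= K)%N ->
  D `<=` Dcdf a b -> D !=set0 ->
  (forall F G (l : R), D F -> D G -> 0 <= l <= 1 ->
     D (fun x => l * F x + (1 - l) * G x)) ->
  0 < C ->
  (forall F G, D F -> Dcdf a b G -> `|T F - T G| <= C * supnorm F G) ->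
  (forall (m : nat) (dl : 'rV[R]_m), simplex dl ->
     measurable_fun [set x : m.-tuple R | forall j, a <= tnth x j <= b]
                    (T_of_sample T dl)) ->
  M `<=` simplex (R:=R) (K:=K) -> closed M ->
  (exists d1 d2, [/\ M d1, M d2 & d1 <> d2]) ->
  (K <= n)%N ->
  is_partition_nonempty Pi ->
  Mn `<=` M -> Mn !=set0 -> finite_set Mn ->
  forall (dsp : measure_display) (Omega : measurableType dsp)
         (P : probability Omega R)
         (Y : nat -> Omega -> K.-tuple R) (F : 'I_K -> R -> R),
  (forall i, D (F i)) ->
  iid_vectors P Y ->
  (forall t i x, P [set w | tnth (Y t w) i <= x] = (F i x)%:E) ->
  (\int[P]_(w in setT) (SA_regret T M Mn Pi F (fun t => Y t w))%:E <=
   (opt_error T D M Mn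
    + 301%:R / 100%:R * C * Num.sqrt (ln (K%:R) / (beta_n Pi)%:R))%:E)%E.
Proof.
move=> _ K2 DDcdf D0 Dconv C0 Tlip _ Msimplex _ _ Kn [Pi_ne _ _] MnM Mn0 Mnfin.
move=> dsp Omega P Y F DF iidY cdfY.
have Pi0 j : (0 < #|Pi j|)%N by rewrite card_gt0.
have FDcdf i : Dcdf a b (F i) by exact: DDcdf.
have n0 : (0 < n)%N by apply: leq_trans Kn; exact: ltnW.
set bt : R := (beta_n Pi)%:R.
have bt0 : 0 < bt by rewrite ltr0n beta_n_gt0.
have K0 : 0 < K%:R :> R by rewrite ltr0n ltnW.
set L : R := ln K%:R.
have lnL : ln 2 <= L by rewrite ler_ln ?posrE// ler_nat.
have L0 : 0 < L by have := ln2_ge R; lra.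
set eps := opt_error T D M Mn.
have eps0 : 0 <= eps.
  exact: le_trans (opt_error_ge DDcdf Dconv C0 Tlip Msimplex MnM Mn0 DF D0).
(* [lam] is the decay rate of the squared deviation, and [Bd] is the target bound divided by
   [2 C]. *)
pose lam : R := 31 / 20 * bt; pose Bd : R := 301 / 200 * Num.sqrt (L / bt).
have lam0 : 0 < lam by rewrite mulr_gt0//; lra.
have Bd0 : 0 < Bd by rewrite mulr_gt0 ?sqrtr_gt0 ?divr_gt0//; lra.
have Bd2 : Bd ^+ 2 = (301 / 200) ^+ 2 * L / bt.
  by rewrite exprMn sqr_sqrtr ?mulrA// divr_ge0// ltW.
(* At [y0] the union bound [2 K expR (- lam y)] equals 1. The slack left by 3.01 serves as step [h],
   so that [y0 + h + lam^-1] is exactly [Bd ^ 2]. *)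
pose y0 : R := (ln 2 + L) / lam; pose h : R := Bd ^+ 2 - y0 - lam^-1.
have y00 : 0 < y0.
  by rewrite divr_gt0//; have := ln2_ge R; lra.
have h0 : 0 < h.
  have -> : h = ((301 / 200) ^+ 2 * L -
      ((ln 2 + L) / (31 / 20) + (31 / 20)^-1)) / bt.
    by rewrite /h Bd2 /y0 /lam; field; rewrite gt_eqF.
  by rewrite divr_gt0// subr_gt0 step_slack_gt0.
(* Thresholds for the deviation, whose squares form a grid of step [h] from [y0] on. *)
pose u k : R := Num.sqrt (y0 + k%:R * h).
have uk0 k : 0 < y0 + k%:R * h.
  by rewrite ltr_pwDl// mulr_ge0// ltW.
have u0 k : 0 < u k by rewrite sqrtr_gt0.
have u2 k : u k ^+ 2 = y0 + k%:R * h by rewrite sqr_sqrtr// ltW.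
pose U k : set Omega := \big[setU/set0]_(j < K) deviates P Y Pi j (u k).
have mU k : measurable (U k).
  apply: bigsetU_measurable => j _; exact: (measurable_deviates Pi iidY).
have PU k : (P (U k) <= (expR (- (lam * (k%:R * h))))%:E)%E.
  apply: le_trans (measure_bigsetU_le P _ _) _ => [j|].
    exact: (measurable_deviates Pi iidY).
  apply: (@le_trans _ _ (\sum_(j < K) (2 * expR (- (lam * (u k ^+ 2))))%:E)%E).
    apply: lee_sum => j _.
    apply: le_trans (deviates_prob _ iidY _ (u0 k)) _.
    rewrite lee_fin ler_pM2l// ler_expR lerN2 ler_wpM2r ?sqr_ge0//.
    by rewrite /lam ler_pM2l ?ler_nat ?beta_n_le//; lra.
  rewrite sumEFin lee_fin sumr_const card_ord u2 mulrDr opprD expRD.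
  have -> : expR (- (lam * y0)) = (2 * K%:R)^-1.
    rewrite /y0 [lam * _]mulrC divfK ?gt_eqF// opprD expRD !expRN.
    by rewrite !lnK ?posrE// invfM.
  set E := expR _; rewrite -[leLHS]mulr_natr.
  by rewrite [leLHS](_ : _ = E)//; field; rewrite gt_eqF.
have [N Nbig] : exists N : nat, 1 < y0 + N%:R * h.
  exists (Num.truncn h^-1).+1; rewrite ltr_wpDl// ?(ltW y00)//.
  by rewrite -ltr_pdivrMr// mul1r truncnS_gt.
have UN : U N = set0.
  rewrite /U big1// => j _; apply: deviates_gt1 => //.
  by rewrite -(@ltr_pXn2r _ 2) ?nnegrE// ?expr1n ?u2// ltW.
have CB0 : 0 < C / Bd by rewrite divr_gt0.
(* The part without [k] of the regret bound after linearizing [u k] at [Bd]. *)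
pose c : R := eps + C / Bd * (y0 + Bd ^+ 2).
have c0 : 0 <= c by rewrite addr_ge0// mulr_ge0 ?addr_ge0 ?sqr_ge0// ltW.
have hC0 : 0 <= C / Bd * h by rewrite mulr_ge0// ltW.
apply: le_trans (integral_le_simple (N := N) c0 hC0 mU PU _) _; last first.
  rewrite lee_fin.
  (* The squared threshold has mean at most [y0 + h + lam^-1 = Bd ^ 2], so the total is
     [eps + 2 C Bd]. *)
  have := ler_wpM2l (ltW CB0) (expR_geometric_le N lam0 h0).
  rewrite mulrA => geo; apply: le_trans (lerD (lexx c) geo) _.
  rewrite /c /h -addrA lerD2l -mulrDr.
  have -> : y0 + Bd ^+ 2 + (Bd ^+ 2 - y0 - lam^-1 + lam^-1) = 2 * Bd * Bd by ring.
  have -> : C / Bd * (2 * Bd * Bd) = 2 * C * Bd by field; rewrite gt_eqF.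
  by rewrite /Bd -/L -/bt; lra.
apply: filterS (sample_ae (n := n) iidY cdfY FDcdf) => w wab.
have exk : exists k, w \notin U k by exists N; rewrite UN in_set0.
(* The first threshold at which no arm deviates; [U N] is empty, so there is one. *)
pose k := ex_minn exk; have [kU kmin] : w \notin U k /\
    (forall i, w \notin U i -> (k <= i)%N) by rewrite /k; case: ex_minnP.
have kN : (k <= N)%N by apply: kmin; rewrite UN in_set0.
have close j x : `|F j x - ecdf_SA Pi (fun t => Y t w) j x| <= u k.
  apply: (not_deviates iidY cdfY FDcdf Pi0) => // dev.
  move/negP: kU; apply; rewrite inE /U -bigcup_seq.
  by exists j => //=; exact: mem_index_enum.
have reg := SA_regret_le DDcdf Dconv C0 Tlip Msimplex MnM Mn0 Mnfin Pi0 DF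
  wab D0 close.
apply: le_trans reg _; rewrite -/eps /c -addrA lerD2l.
(* By minimality [w] lies in every [U i] with [i < k], so the indicators count at least [k]. *)
have ksum : k%:R <= \sum_(i < N) \1_(U i) w :> R.
  rewrite -(big_mkord xpredT (fun i => \1_(U i) w : R)) (big_cat_nat (n := k))//=.
  rewrite -[leLHS]addr0 lerD ?sumr_ge0// big_nat.
  rewrite (eq_bigr (fun _ => 1)) => [|i /andP[_ ik]].
    by rewrite -big_nat sumr_const_nat subn0.
  rewrite indicE; case: (boolP (w \in U i)) => // /kmin.
  by rewrite leqNgt ik.
(* [Bd] is the target bound on the mean of [u k], and its square exceeds the
   mean of [u k ^ 2], so nothing is lost in linearizing [u k] at [Bd]. *)
have amgm : 2 * u k * Bd <= u k ^+ 2 + Bd ^+ 2.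
  by have := sqr_ge0 (u k - Bd); lra.
have -> : 2 * C * u k = C / Bd * (2 * u k * Bd) by field; rewrite gt_eqF.
rewrite -[C / Bd * h * _]mulrA -mulrDr ler_pM2l//; apply: le_trans amgm _.
by rewrite u2 addrAC lerD2l [leRHS]mulrC ler_pM2r.
Qed.
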